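(* For every positive integer $n$, $A_n(\mathbb{C}) \subseteq \{d>0 : d^2 \in \mathbb{Q}\}$.
   Context: For $u=(u_1,\dots,u_n)$, $v=(v_1,\dots,v_n)\in\mathbb{C}^n$, $\varphi_n(u,v)=(u_1-v_1)^2+\dots+(u_n-v_n)^2\in\mathbb{C}$ (no complex conjugation). For a real number $d\ge 0$, a map $g:\mathbb{R}^n\to\mathbb{C}^n$ preserves distance $d$ if for all $x,y\in\mathbb{R}^n$, $|x-y|=d$ (Euclidean distance) implies $\varphi_n(g(x),g(y))=d^2$. It preserves unit distance if it preserves distance $1$. $A_n(\mathbb{C})$ is the set of all real numbers $d>0$ such that every map $g:\mathbb{R}^n\to\mathbb{C}^n$ that preserves unit distance also preserves distance $d$. *)

(* Defs.v *)
From mathcomp Require Import all_boot all_order all_algebra.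
From mathcomp Require Import complex.
From mathcomp Require Import boolp classical_sets reals.

Set Implicit Arguments.
Unset Strict Implicit.
Unset Printing Implicit Defensive.

Import Order.TTheory GRing.Theory Num.Theory.
Local Open Scope classical_set_scope.
Local Open Scope complex_scope.
Local Open Scope ring_scope.

(* The canonical norm on matrices is the sup norm, hence this definition. *)
Definition edist (R : realType) (n : nat) (x y : 'rV[R]_n) : R :=
  Num.sqrt (\sum_(i < n) (x ord0 i - y ord0 i) ^+ 2).

(* Bilinear rather than Hermitian: there is no complex conjugation. *)
Definition phi (R : realType) (n : nat) (u v : 'rV[R[i]]_n) : R[i] :=
  \sum_(i < n) (u ord0 i - v ord0 i) ^+ 2.

(* Only meaningful for 0 <= d, since edist is nonnegative. *)
Definition preserves_distance (R : realType) (n : nat)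
    (g : 'rV[R]_n -> 'rV[R[i]]_n) (d : R) : Prop :=
  forall x y : 'rV[R]_n, edist x y = d -> phi (g x) (g y) = d%:C ^+ 2.

Definition AnC (R : realType) (n : nat) : set R :=
  [set d | 0 < d /\
    forall g : 'rV[R]_n -> 'rV[R[i]]_n,
      preserves_distance g 1 -> preserves_distance g d].
Arguments AnC : clear implicits.

(* Main.v *)
Require Import Defs.
From mathcomp Require Import all_boot all_order all_algebra.
From mathcomp Require Import complex.
From mathcomp Require Import boolp classical_sets reals.
From HB Require Import structures.

(** A ring embedding sigma of R into R[i], applied to each coordinate, turns
the squared distance of two points x and y into
phi (sigma x) (sigma y) = sigma (|x - y|^2) (lemma [phi_map]).  It therefore
preserves unit distance, since sigma 1 = 1, and it preserves distance d only if
sigma fixes d^2.  So it is enough to show that every irrational real number a is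
moved by some embedding of R into R[i] (lemma [embedding_moving]).

To move a, let K be a subfield of R that is maximal among those not containing
a; one exists by Zorn's lemma, as a is irrational.  Then R is algebraic over K
([maximal_avoiding_algebraic]).  The irreducible polynomial of a over K has
degree at least 2, since a is not in K, and so it has in R[i] a root b different
from a, the characteristic being 0 ([irreducible_second_root]).  The K-embedding
K(a) -> R[i] sending a to b extends to R because R is algebraic over K and R[i]
is algebraically closed ([extend_embedding]).

An embedding of a subfield of E into F is handled through its graph: a subfield
of the product ring E * F, that is, a subring whose nonzero elements are
units of E * F and have their inverses in the subring.  Neither coordinate of a
nonzero element can then vanish, which says both that the relation is functional
and that it is injective.  One notion of subfield of a commutative ring thus
serves both maximality arguments ([maximal_subfield]), for R and for R * R[i],
and the single construction [adjoin_irreducible_root], used in the product ring,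
adjoins to a partial embedding one more argument with its value. *)

Set Implicit Arguments.
Unset Strict Implicit.
Unset Printing Implicit Defensive.

Import Order.TTheory GRing.Theory Num.Theory.
Local Open Scope classical_set_scope.
Local Open Scope ring_scope.

(** * Subfields of commutative rings *)

(** The ambient ring need not be a field; it will also be a product of two
fields.  As 0^-1 = 0, closure under division asks nothing new of the divisor 0. *)
Record is_subfield (A : comUnitRingType) (S : set A) : Prop := IsSubfield {
  subfield1 : S 1;
  subfieldB : forall x y, S x -> S y -> S (x - y);
  subfield_div : forall x y, S x -> S y -> S (x / y);
  subfield_unit : forall x, S x -> x != 0 -> x \is a GRing.unit }.

Lemma subfieldM (A : comUnitRingType) (S : set A) (x y : A) :
  is_subfield S -> S x -> S y -> S (x * y).
Proof.
move=> subS Sx Sy; rewrite -[y]invrK -[y^-1]mul1r.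
apply: (subfield_div subS Sx).
exact: (subfield_div subS (subfield1 subS) Sy).
Qed.

Lemma subfield_range (K : fieldType) (A : comUnitRingType)
  (j : {rmorphism K -> A}) : is_subfield (range j).
Proof.
split.
- by exists 1; rewrite // rmorph1.
- by move=> _ _ [x _ <-] [y _ <-]; exists (x - y); rewrite // rmorphB.
- move=> _ _ [x _ <-] [y _ <-]; exists (x / y) => //.
  by rewrite rmorphM fmorphV.
- move=> _ [x _ <-] jx_neq0; apply: rmorph_unit; rewrite unitfE.
  by apply: contra_neq jx_neq0 => ->; rewrite rmorph0.
Qed.

Section SubfieldType.
Variables (A : comUnitRingType) (S : set A) (subS : is_subfield S).

(** The closure instance is inferred from the predicate alone, so the predicate
carries the proof that S is a subfield. *)
Definition subfield_pred (_ : is_subfield S) : {pred A} := fun x => `[< S x >].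

Local Notation pS := (subfield_pred subS).

Fact subfield_closed : divring_closed pS.
Proof.
split; first exact/asboolP/(subfield1 subS).
- by move=> x y /asboolP Sx /asboolP Sy; exact/asboolP/(subfieldB subS).
- by move=> x y /asboolP Sx /asboolP Sy; exact/asboolP/(subfield_div subS).
Qed.

HB.instance Definition _ := GRing.isDivringClosed.Build A pS subfield_closed.

Definition subfield_carrier := {x : A | pS x}.
Local Notation carrier := subfield_carrier.

HB.instance Definition _ := SubChoice.on carrier.

HB.instance Definition _ :=
  [SubChoice_isSubComUnitRing of carrier by <:].

Fact subfield_field_axiom : GRing.field_axiom carrier.
Proof.
move=> x x_neq0; rewrite unfold_in /=.
apply/(subfield_unit subS); first exact/asboolP/(valP x).
by apply: contra_neq x_neq0 => x0; apply/val_inj.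
Qed.

HB.instance Definition _ :=
  GRing.ComUnitRing_isField.Build carrier subfield_field_axiom.

(** Presents a subfield as the image of an abstract field, over which the theory
of polynomials and of their divisibility is available. *)
Lemma subfield_type :
  exists (K : fieldType) (j : {rmorphism K -> A}), range j = S.
Proof.
exists carrier, (val : {rmorphism carrier -> A}).
apply/seteqP; split=> [_ [x _ <-]|x Sx]; first exact/asboolP/(valP x).
by exists (exist _ x (asboolT Sx)).
Qed.

End SubfieldType.

(** Zorn's lemma: the axioms of a subfield involve at most two elements at a
time, and two elements of the union of a chain lie in a common member. *)
Lemma maximal_subfield (A : comUnitRingType) (S0 B : set A) :
    is_subfield S0 -> (forall x, S0 x -> ~ B x) ->
  exists S, [/\ is_subfield S, S0 `<=` S, forall x, S x -> ~ B x &
    forall S', is_subfield S' -> S `<=` S' -> (forall x, S' x -> ~ B x) ->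
      S' `<=` S].
Proof.
move=> subS0 avoidS0.
pose Q S := [/\ is_subfield S, S0 `<=` S & forall x, S x -> ~ B x].
(* The union of the empty chain is set0, which is not a subfield, so set0 has to
be allowed beside the subfields containing S0. *)
have [|S [PS maxS]] := @Zorn_bigcup A (fun S => S = set0 \/ Q S).
  move=> F FP totF.
  have [[S1 [FS1 QS1]]|noQ] := pselect (exists S, F S /\ Q S); last first.
    left; apply/seteqP; split=> // x [S FS Sx].
    have [S_0|QS] := FP _ FS; first by rewrite S_0 in Sx.
    by case: noQ; exists S.
  right.
  have QF S x : F S -> S x -> Q S.
    by move=> FS Sx; have [S_0|//] := FP _ FS; rewrite S_0 in Sx.
  have dirF x y : (\bigcup_(X in F) X) x -> (\bigcup_(X in F) X) y ->
      exists S, [/\ F S, is_subfield S, S x & S y].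
    move=> [X FX Xx] [Y FY Yy].
    have [XY|YX] := totF _ _ FX FY.
      by exists Y; split=> //; [have [] := QF _ _ FY Yy | exact: XY].
    by exists X; split=> //; [have [] := QF _ _ FX Xx | exact: YX].
  split.
  - split.
    + by exists S1 => //; have [subS1 _ _] := QS1; exact: subfield1.
    + move=> x y Ux Uy; have [S [FS subS Sx Sy]] := dirF _ _ Ux Uy.
      by exists S => //; exact: subfieldB.
    + move=> x y Ux Uy; have [S [FS subS Sx Sy]] := dirF _ _ Ux Uy.
      by exists S => //; exact: subfield_div.
    + move=> x Ux; have [S [FS subS Sx _]] := dirF _ _ Ux Ux.
      exact: (subfield_unit subS).
  - by move=> x S0x; exists S1 => //; have [_ S01 _] := QS1; exact: S01.
  - by move=> x [S FS Sx]; have [_ _] := QF _ _ FS Sx; exact.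
have QS : Q S.
  have [S_0|//] := PS; case: (maxS S0); last by right; split.
  rewrite S_0; split; first exact: sub0set.
  by move=> /(_ 1 (subfield1 subS0)).
exists S; have [subS S0S avoidS] := QS; split=> // S' subS' SS' avoidS' x S'x.
apply: contrapT => nSx; apply: (maxS S').
  by split=> // /(_ x S'x).
by right; split=> // y S0y; exact/SS'/S0S.
Qed.

(** * Irreducible polynomials and simple extensions *)

Section AlgebraicElements.
Variables (K E : fieldType) (j : {rmorphism K -> E}).

(** A nonzero polynomial of least size among those that vanish at t. *)
Lemma minimal_polynomial (t : E) : algebraicOver j t ->
  exists m : {poly K}, irreducible_poly m /\ root (map_poly j m) t.
Proof.
case=> p p_neq0 pt0.
pose deg n := `[< exists q : {poly K},
  [/\ q != 0, root (map_poly j q) t & size q = n] >].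
have ex_deg : exists n, deg n by exists (size p); apply/asboolP; exists p.
have [_ /asboolP[m [m_neq0 mt0 <-]] min_m] := ex_minnP ex_deg.
have {}min_m q : q != 0 -> root (map_poly j q) t -> (size m <= size q)%N.
  by move=> q_neq0 qt0; apply/min_m/asboolP; exists q.
exists m; split=> //; split.
  rewrite ltnNge; apply/negP => /size1_polyC m_const.
  move: mt0 m_neq0; rewrite m_const map_polyC rootC fmorph_eq0 polyC_eq0.
  by move=> ->.
move=> q q_size /dvdpP[r mE].
have /andP[r_neq0 q_neq0] : (r != 0) && (q != 0).
  by rewrite -negb_or -mulf_eq0 -mE.
have size_m : (size m = (size r + size q).-1)%N by rewrite mE size_mul.
move: mt0; rewrite mE rmorphM rootM => /orP[rt0|qt0].
  have := min_m _ r_neq0 rt0; move: size_m q_size.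
  have: (0 < size q)%N by rewrite size_poly_gt0.
  have: (0 < size r)%N by rewrite size_poly_gt0.
  case: (size q) (size r) => [|[|a]] [|b] //= _ _ -> _.
  by rewrite !addnS ltnNge leq_addr.
rewrite -dvdp_size_eqp ?dvdp_mull // eqn_leq -{2}mE min_m //.
by rewrite dvdp_leq // ?dvdp_mull // mulf_neq0.
Qed.

(** Otherwise m and q are coprime and a Bezout relation evaluates to 0 = 1
at u. *)
Lemma irreducible_root_dvdp (A : comUnitRingType) (f : {rmorphism K -> A})
    (u : A) (m q : {poly K}) :
  irreducible_poly m -> root (map_poly f m) u -> root (map_poly f q) u ->
  m %| q.
Proof.
move=> irr_m /rootP mu0 /rootP qu0; apply/negPn/negP.
rewrite -irreducible_poly_coprime // => /Bezout_eq1_coprimepP[[v w] /= vw1].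
have /eqP := congr1 (fun p => (map_poly f p).[u]) vw1.
rewrite rmorphD !rmorphM rmorph1 !hornerE mu0 qu0 !mulr0 addr0.
by rewrite eq_sym oner_eq0.
Qed.

End AlgebraicElements.

(** The values at u of all polynomials over K form a subfield: such a value is
nonzero only if the polynomial is coprime to m, and a Bezout relation then gives
an inverse that is again a value.  The case of interest is that of a product A
of two fields. *)
Lemma adjoin_irreducible_root (K : fieldType) (A : comUnitRingType)
    (f : {rmorphism K -> A}) (u : A) (m : {poly K}) :
    irreducible_poly m -> root (map_poly f m) u ->
  exists S, [/\ is_subfield S, range f `<=` S & S u].
Proof.
move=> irr_m /rootP mu0; pose ev p := (map_poly f p).[u].
have ev_unit p : ev p != 0 -> exists r, ev p * ev r = 1.
  move=> pu_neq0; have : coprimep m p.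
    rewrite irreducible_poly_coprime //; apply: contra_neqN pu_neq0.
    by move=> /dvdpP[r ->]; rewrite /ev rmorphM hornerM mu0 mulr0.
  move=> /Bezout_eq1_coprimepP[[v w] /= vw1]; exists w.
  have := congr1 ev vw1; rewrite /ev rmorphD !rmorphM rmorph1 !hornerE mu0.
  by rewrite mulr0 add0r mulrC.
exists (range ev); split; first split.
- by exists 1; rewrite // /ev rmorph1 hornerC.
- move=> _ _ [p _ <-] [q _ <-]; exists (p - q) => //.
  by rewrite /ev rmorphB !hornerE.
- move=> _ _ [p _ <-] [q _ <-].
  have [->|/ev_unit[r qr1]] := eqVneq (ev q) 0.
    by exists 0; rewrite // invr0 mulr0 /ev rmorph0 hornerC.
  exists (p * r) => //.
  have q_unit : ev q \is a GRing.unit by apply/unitrPr; exists (ev r).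
  rewrite /ev rmorphM hornerM -!/(ev _); congr (_ * _).
  by apply: (mulrI q_unit); rewrite qr1 divrr.
- by move=> _ [p _ <-] /ev_unit[r pr1]; apply/unitrPr; exists (ev r).
- by move=> _ [c _ <-]; exists c%:P; rewrite // /ev map_polyC hornerC.
- by exists 'X; rewrite // /ev map_polyX hornerX.
Qed.

(** The subfield generated by the image of K and by t. *)
Definition rational_values (K E : fieldType) (j : K -> E) (t : E) : set E :=
  [set x | exists p q : {poly K}, (map_poly j q).[t] != 0 /\
    x = (map_poly j p).[t] / (map_poly j q).[t]].

Section SimpleExtension.
Variables (K E : fieldType) (j : {rmorphism K -> E}) (t : E).

Lemma rational_values_subfield : is_subfield (rational_values j t).
Proof.
split.
- by exists 1, 1; rewrite rmorph1 hornerC oner_neq0 divr1.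
- move=> _ _ [p [q [q0 ->]]] [p' [q' [q'0 ->]]].
  exists (p * q' - p' * q), (q * q').
  rewrite rmorphB !rmorphM !hornerE mulf_neq0 //; split=> //.
  by rewrite -mulNr addf_div // mulNr.
- move=> _ _ [p [q [q0 ->]]] [p' [q' [q'0 ->]]].
  have [->|p'0] := eqVneq (map_poly j p').[t] 0.
    exists 0, 1; rewrite rmorph1 rmorph0 !hornerC oner_neq0; split=> //.
    by rewrite mul0r invr0 mulr0 mul0r.
  exists (p * q'), (q * p'); rewrite !rmorphM !hornerE mulf_neq0 //; split=> //.
  by rewrite invf_div mulf_div.
- by move=> x _; rewrite unitfE.
Qed.

Lemma rational_values_base : range j `<=` rational_values j t.
Proof.
move=> _ [c _ <-]; exists c%:P, 1.
by rewrite rmorph1 map_polyC !hornerC oner_neq0 divr1.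
Qed.

Lemma rational_values_gen : rational_values j t t.
Proof.
by exists 'X, 1; rewrite rmorph1 map_polyX hornerX hornerC oner_neq0 divr1.
Qed.

End SimpleExtension.

(** * Subfields maximal among those avoiding an element *)

(** For t outside K, maximality puts a in K(t), say a = p(t) / q(t).  With
t = a^2 this yields a polynomial X q(X^2) - p(X^2) that kills a, so a is
algebraic over K.  For a general t it yields a q(X) - p(X), a polynomial over
K(a) that kills t and is nonzero as a is not in K; hence t is algebraic over
K(a), and so over K. *)
Lemma maximal_avoiding_algebraic (K E : fieldType) (j : {rmorphism K -> E})
    (a : E) :
    ~ range j a ->
    (forall S, is_subfield S -> range j `<=` S -> ~ S a -> S `<=` range j) ->
  forall t, algebraicOver j t.
Proof.
move=> Ka maxK.
have Ka_gen t : ~ range j t -> rational_values j t a.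
  move=> Kt; apply: contrapT => nSa; apply: Kt.
  apply: (maxK _ (rational_values_subfield j t)) => //.
    exact: rational_values_base.
  exact: rational_values_gen.
have alg_a : algebraicOver j a.
  have [[c _ jc]|/Ka_gen[p [q [q_neq0 aE]]]] := pselect (range j (a ^+ 2)).
    exists ('X^2 - c%:P).
      by rewrite -size_poly_gt0 size_XnsubC.
    rewrite rmorphB /= map_polyXn map_polyC rootE hornerD hornerN.
    by rewrite hornerXn hornerC /= jc subrr.
  exists ('X * (q \Po 'X^2) - (p \Po 'X^2)).
    (* The odd coefficients of X q(X^2) - p(X^2) are the coefficients of q. *)
    apply: contra_neq q_neq0 => /polyP pq0.
    suff -> : q = 0 by rewrite rmorph0 hornerC.
    apply/polyP => i; have := pq0 (2 * i).+1.
    rewrite coefB coefXM /= !coef_comp_poly_Xn // dvdn_mulr // mulKn //.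
    by rewrite dvdn2 /= mul2n odd_double subr0 !coef0.
  rewrite rootE rmorphB rmorphM /= map_polyX !map_comp_poly !map_polyXn.
  rewrite hornerD hornerN hornerM !horner_comp hornerX hornerXn.
  by rewrite {1}aE divfK // subrr.
move=> t.
have [[c _ <-]|/Ka_gen[p [q [q_neq0 aE]]]] := pselect (range j t).
  exact: algebraic_id.
apply/integral_algebraic.
apply: (@integral_root _ _ j (a *: map_poly j q - map_poly j p)).
(* If a q = p, the coefficients of both sides at the degree of q express a as a
quotient of elements of K. *)
- apply/eqP => /polyP pq0; apply: Ka.
  have q_coef_neq0 : lead_coef q != 0.
    rewrite lead_coef_eq0; apply: contra_neq q_neq0 => ->.
    by rewrite rmorph0 hornerC.
  exists (p`_(size q).-1 / lead_coef q) => //.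
  have := pq0 (size q).-1; rewrite coefB coefZ !coef_map coef0 => /subr0_eq.
  rewrite -lead_coefE => jp; rewrite fmorph_div /= -jp mulfK //.
  by rewrite fmorph_eq0.
- by rewrite rootE !hornerE {1}aE divfK // subrr.
- apply/integral_poly => i; rewrite coefB coefZ !coef_map.
  apply: integral_sub; last exact: integral_id.
  apply: integral_mul; last exact: integral_id.
  exact/integral_algebraic.
Qed.

(** * Embeddings into an algebraically closed field *)

(** Divide m by X - iota a: the quotient r is not constant, because m has degree
at least 2, so it has a root b.  If b were iota a, then iota a would be a double
root of m, so a would be a root of the derivative of m, which is nonzero in
characteristic 0 and of smaller degree than the irreducible polynomial m. *)
Lemma irreducible_second_root (K : fieldType) (E : numFieldType)
    (F : closedFieldType) (j : {rmorphism K -> E}) (iota : {rmorphism E -> F})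
    (a : E) (m : {poly K}) :
    irreducible_poly m -> root (map_poly j m) a -> ~ range j a ->
  exists2 b, root (map_poly (iota \o j) m) b & b != iota a.
Proof.
move=> irr_m ma0 Ka; have m_neq0 := irredp_neq0 irr_m.
have map_comp p : map_poly (iota \o j) p = map_poly iota (map_poly j p).
  by rewrite map_poly_comp.
have : root (map_poly (iota \o j) m) (iota a).
  by rewrite map_comp fmorph_root.
move=> /factor_theorem[r mE].
have size_m : (2 < size m)%N.
  rewrite ltn_neqAle eq_sym; have [-> _] := irr_m; rewrite andbT.
  apply/eqP => size_m2; apply: Ka; exists (- (m`_0 / m`_1)) => //.
  have m1_neq0 : j m`_1 != 0.
    by rewrite fmorph_eq0 -[1%N]/(2.-1) -size_m2 -lead_coefE lead_coef_eq0.
  move: ma0; rewrite rootE horner_coef size_map_poly size_m2.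
  rewrite big_ord_recl big_ord1 !coef_map expr0 expr1 mulr1 /=.
  rewrite addrC addr_eq0 => /eqP m1a.
  by apply: (mulfI m1_neq0); rewrite m1a rmorphN fmorph_div mulrN mulrC divfK.
have r_neq0 : r != 0.
  apply: contra_neq m_neq0 => r0; apply/eqP.
  by rewrite -(map_poly_eq0 (iota \o j)) mE r0 mul0r.
have [b rb0] : exists b, root r b.
  apply/closed_rootP; have := congr1 (fun p : {poly F} => size p) mE.
  rewrite size_map_poly size_mul ?polyXsubC_eq0 // size_XsubC addn2 /= => sz.
  by apply/eqP => sr; rewrite sz sr in size_m.
exists b; first by rewrite mE rootM rb0.
apply/eqP => ba; rewrite {}ba in rb0.
have dm0 : root (map_poly j m^`()) a.
  rewrite -(fmorph_root iota) -map_comp -deriv_map mE derivM derivXsubC mulr1.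
  by rewrite rootE !hornerE (rootP rb0) subrr mulr0 addr0.
have dm_neq0 : m^`() != 0.
  apply/eqP => /polyP /(_ (size m).-2); rewrite coef_deriv coef0.
  move=> /(congr1 j); rewrite rmorphMn rmorph0 => /eqP.
  have -> : (size m).-2.+1 = (size m).-1 by case: (size m) size_m => [|[]].
  rewrite mulrn_eq0 fmorph_eq0 -lead_coefE lead_coef_eq0 (negPf m_neq0) orbF.
  by case: (size m) size_m => [|[]].
have := dvdp_leq dm_neq0 (irreducible_root_dvdp irr_m ma0 dm0).
by rewrite leqNgt lt_size_deriv.
Qed.

Lemma map_poly_lift (K T E : fieldType) (j : {rmorphism K -> E})
    (i : {rmorphism T -> E}) (p : {poly K}) :
  range j `<=` range i -> exists q, map_poly i q = map_poly j p.
Proof.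
move=> ji.
have /choice[c cE] k : exists x, i x = j p`_k.
  by have [x _ ix] : range i (j p`_k) by [apply: ji; exists p`_k]; exists x.
exists (\poly_(k < size p) c k); apply/polyP => k; rewrite !coef_map coef_poly.
case: ltnP => [_|le_pk]; first exact: cE.
rewrite [in RHS]nth_default //.
exact: etrans (rmorph0 i) (esym (rmorph0 j)).
Qed.

(** Evaluation in a product ring is coordinatewise. *)
Lemma root_pair (K E F : fieldType) (f : {rmorphism K -> (E * F)%type})
    (m : {poly K}) (t : E) (s : F) :
    root (map_poly (fst \o f) m) t -> root (map_poly (snd \o f) m) s ->
  root (map_poly f m) (t, s).
Proof.
have e1 := horner_map (fst : {rmorphism E * F -> E}) (map_poly f m) (t, s).
have e2 := horner_map (snd : {rmorphism E * F -> F}) (map_poly f m) (t, s).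
rewrite -!map_poly_comp /= in e1 e2 => /rootP mt0 /rootP ms0.
by rewrite rootE [X in X == _]surjective_pairing -e1 -e2 mt0 ms0.
Qed.

(** S0 is the graph of an embedding of a subfield of E that contains j K.  Its
maximal extension G is defined everywhere: any t is algebraic over the domain of
G, the irreducible polynomial m of t, carried to F by the second coordinate of
G, has a root s in F, and (t, s) can be adjoined to G because it is a root of m
in the product ring. *)
Lemma extend_embedding (K E : fieldType) (F : closedFieldType)
    (j : {rmorphism K -> E}) (S0 : set (E * F)) :
    (forall t, algebraicOver j t) -> is_subfield S0 ->
    (forall c, exists y, S0 (j c, y)) ->
  exists sigma : {rmorphism E -> F}, forall x y, S0 (x, y) -> sigma x = y.
Proof.
move=> alg subS0 KS0.
have [|G [subG S0G _ maxG]] := @maximal_subfield _ S0 set0 subS0.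
  by move=> x _ [].
(* A difference (0, y - z) with y != z is a nonzero nonunit. *)
have functionalG x y z : G (x, y) -> G (x, z) -> y = z.
  move=> Gxy Gxz; apply/eqP; rewrite -subr_eq0; apply/negPn/negP => yz_neq0.
  have := subfieldB subG Gxy Gxz.
  move=> /(subfield_unit subG)/=.
  have -> : (x, y) - (x, z) = (0, y - z) :> E * F.
    by rewrite -[LHS]/(x - x, y - z) subrr.
  have -> : ((0, y - z) != 0 :> E * F) by apply: contra_neq yz_neq0 => -[].
  by move=> /(_ isT); rewrite unfold_in /= unitr0.
have totalG t : exists y, G (t, y).
  have [T [f fG]] := subfield_type subG.
  pose f1 : {rmorphism T -> E} := fst \o f.
  pose f2 : {rmorphism T -> F} := snd \o f.
  have alg_t : algebraicOver f1 t.
    have [p p_neq0 pt0] := alg t.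
    have [|q qE] := @map_poly_lift _ _ _ j f1 p.
      move=> _ [c _ <-]; have [y /S0G] := KS0 c.
      by rewrite -fG => -[x _ fx]; exists x => //=; rewrite fx.
    exists q; last by rewrite qE.
    by rewrite -(map_poly_eq0 f1) qE map_poly_eq0.
  have [m [irr_m mt0]] := minimal_polynomial alg_t.
  have [s ms0] : exists s, root (map_poly f2 m) s.
    apply/closed_rootP; rewrite size_map_poly; have [+ _] := irr_m.
    by case: ltngtP.
  have m_ts0 : root (map_poly f m) (t, s) by apply: root_pair.
  have [S [subS GS Sts]] := adjoin_irreducible_root irr_m m_ts0.
  by rewrite fG in GS; exists s; apply: (maxG S subS GS) => // x _ [].
have [sigma sigmaG] := choice totalG.
have sigmaE x y : G (x, y) -> sigma x = y by apply: functionalG.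
have sigmaB : zmod_morphism sigma.
  move=> x y; apply: sigmaE.
  exact: (subfieldB subG (sigmaG x) (sigmaG y)).
have sigma1 : sigma 1 = 1 by apply: sigmaE; exact: subfield1 subG.
have sigmaM : {morph sigma : x y / x * y}.
  by move=> x y; apply: sigmaE; exact: (subfieldM subG (sigmaG x) (sigmaG y)).
pose sZ := GRing.isZmodMorphism.Build _ _ sigma sigmaB.
pose sM := GRing.isMonoidMorphism.Build _ _ sigma (conj sigma1 sigmaM).
pose sR : {rmorphism E -> F} := HB.pack sigma sZ sM.
by exists sR => x y /S0G /sigmaE.
Qed.

(** Over a maximal subfield K avoiding a, the element a has a conjugate b in F
other than iota a.  Adjoining (a, b) to the graph of iota on K, in the product ring
E * F, gives the partial embedding that is then extended to E. *)
Lemma embedding_moving (E : numFieldType) (F : closedFieldType)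
    (iota : {rmorphism E -> F}) (a : E) :
    ~ range (@ratr E) a ->
  exists sigma : {rmorphism E -> F}, sigma a != iota a.
Proof.
move=> irrat_a.
have [|S [subS _ Sa maxS]] :=
    @maximal_subfield _ _ [set a] (subfield_range (ratr : {rmorphism rat -> E})).
  by move=> _ [q _ <-] /= qa; apply: irrat_a; exists q.
have [K [j jS]] := subfield_type subS.
have Ka : ~ range j a by rewrite jS => /Sa; apply.
have alg : forall t, algebraicOver j t.
  apply: (maximal_avoiding_algebraic Ka) => S' subS' + S'a.
  by rewrite jS => SS'; apply: maxS => // x S'x xa; apply: S'a; rewrite -xa.
have [m [irr_m ma0]] := minimal_polynomial (alg a).
have [b mb0 b_neq] := irreducible_second_root iota irr_m ma0 Ka.
pose f1 : {rmorphism K -> E} := j.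
pose f2 : {rmorphism K -> F} := iota \o j.
pose f c := (f1 c, f2 c).
have fB : zmod_morphism f by move=> x y; rewrite /f !rmorphB.
have fM : monoid_morphism f.
  by split; rewrite /f ?rmorph1 // => x y; rewrite !rmorphM.
pose fZm := GRing.isZmodMorphism.Build _ _ f fB.
pose fMm := GRing.isMonoidMorphism.Build _ _ f fM.
pose fR : {rmorphism K -> (E * F)%type} := HB.pack f fZm fMm.
have m_ab0 : root (map_poly fR m) (a, b) by apply: root_pair.
have [S0 [subS0 KS0 S0ab]] := adjoin_irreducible_root irr_m m_ab0.
have [|sigma sigmaE] := extend_embedding alg subS0.
  by move=> c; exists (iota (j c)); apply: KS0; exists c.
by exists sigma; rewrite (sigmaE _ _ S0ab).
Qed.

(** * Distances *)

Lemma phi_map (R : realType) (n : nat) (sigma : {rmorphism R -> R[i]})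
    (x y : 'rV[R]_n) :
  phi (map_mx sigma x) (map_mx sigma y) = sigma (edist x y ^+ 2).
Proof.
rewrite /phi /edist sqr_sqrtr; last by apply: sumr_ge0 => i _; exact: sqr_ge0.
by rewrite rmorph_sum; apply: eq_bigr => i _; rewrite !mxE rmorphXn rmorphB.
Qed.

Lemma exists_edist (R : realType) (n : nat) (d : R) :
  (0 < n)%N -> 0 <= d -> exists x y : 'rV[R]_n, edist x y = d.
Proof.
case: n => // n _ d_ge0; exists (d *: delta_mx ord0 ord0), 0.
rewrite /edist (bigD1 ord0) //= big1 => [|i /negPf i_neq0].
  by rewrite !mxE !eqxx mulr1 subr0 addr0 sqrtr_sqr ger0_norm.
by rewrite !mxE i_neq0 andbF mulr0 subr0 expr0n.
Qed.

Theorem mainTheorem6 (R : realType) (n : nat) (hn : (0 < n)%N) :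
  AnC R n `<=` [set d : R | 0 < d /\ rational (d ^+ 2)].
Proof.
move=> d [d_gt0 dA]; split=> //; apply: contrapT => irrat_d.
have [sigma] := embedding_moving (real_complex R) irrat_d.
have [x [y xyd]] := exists_edist hn (ltW d_gt0).
have preserves1 : @preserves_distance R n (map_mx sigma) 1.
  by move=> u v uv1; rewrite phi_map uv1 -rmorphXn expr1n !rmorph1.
have := dA _ preserves1 x y xyd; rewrite phi_map xyd => ->.
by rewrite rmorphXn eqxx.
Qed.
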